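(* The graded connected coalgebra $(\mathcal{H}_{\mathbb{T}},\Delta)$ is cofree: it is isomorphic, as a coalgebra, to the tensor coalgebra $T(\mathrm{Prim}(\mathcal{H}_{\mathbb{T}}))$ on the space of its primitive elements, endowed with the deconcatenation coproduct.
   Context: Let $K$ be a field. For $n\geq0$, $[n]=\{1,\ldots,n\}$, $\mathbb{T}_n$ is the set of topologies on $[n]$, and $\mathcal{H}_{\mathbb{T}}$ is the $K$-vector space with basis $\bigsqcup_{n\ge0}\mathbb{T}_n$, graded by degree $n$ on $\mathbb{T}_n$. For a topology $\mathcal{T}$ on a finite set $X$ and $Y\subseteq X$, $\mathcal{T}_{\mid Y}=\{O\cap Y\mid O\in\mathcal{T}\}$; if $X$ is totally ordered of cardinality $m$, $\mathrm{Std}(\mathcal{T})\in\mathbb{T}_m$ is the image of $\mathcal{T}$ under the unique increasing bijection $X\to[m]$. The coproduct is $\Delta(\mathcal{T})=\sum_{O\in\mathcal{T}}\mathrm{Std}(\mathcal{T}_{\mid [n]\setminus O})\otimes\mathrm{Std}(\mathcal{T}_{\mid O})$ for $\mathcal{T}\in\mathbb{T}_n$, extended linearly. An element $x$ is primitive if $\Delta(x)=x\otimes1+1\otimes x$, where $1$ is the empty topology. *)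

(* Defs.v *)
(* free vector spaces are modelled with multinomials' monalg:
   {malg K[A]} = finitely supported functions A -> K = the K-vector space with basis A. *)
From HB Require Import structures.
From mathcomp Require Import all_boot all_order all_algebra.
From mathcomp Require Import finmap.
From mathcomp.multinomials Require Import monalg.

Set Implicit Arguments.
Unset Strict Implicit.
Unset Printing Implicit Defensive.

Import GRing.Theory.
Local Open Scope ring_scope.

(* Topologies on [n] = 'I_n  (finite: closure under pairwise unions and
   intersections is closure under arbitrary unions / finite intersections) *)
Definition is_topology (n : nat) (T : {set {set 'I_n}}) : bool :=
  [&& set0 \in T, [set: 'I_n] \in T &
      [forall O1 in T, forall O2 in T, (O1 :|: O2 \in T) && (O1 :&: O2 \in T)]].

Definition topo (n : nat) := {T : {set {set 'I_n}} | is_topology T}.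

Definition Topo := {n : nat & topo n}.

(* Std (T_|Y) : restriction to Y followed by the increasing bijection Y -> [#|Y|] *)
Definition rank_in (n : nat) (Y : {set 'I_n}) (i : 'I_n) : nat :=
  #|[set j in Y | (j < i)%N]|.

Definition std_open (n : nat) (Y O : {set 'I_n}) : {set 'I_#|Y|} :=
  [set k : 'I_#|Y| | [exists i in O :&: Y, rank_in Y i == k]].

Definition std_restr (n : nat) (T : {set {set 'I_n}}) (Y : {set 'I_n})
  : {set {set 'I_#|Y|}} := [set std_open Y O | O in T].

Section Coalg.
Variable K : fieldType.

Definition H := {malg K[Topo]}.
Definition HH := {malg K[(Topo * Topo)%type]}.            (* H_T (x) H_T *)
Definition TH := {malg K[seq Topo]}.               (* T(H_T) = (+)_k H_T^{(x)k} *)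
Definition TT := {malg K[(seq Topo * seq Topo)%type]}.    (* T(H_T) (x) T(H_T) *)

Definition lin_ext (A : choiceType) (V : lmodType K) (f : A -> V)
  (g : {malg K[A]}) : V := \sum_(a <- msupp g) g@_a *: f a.

Definition tens (A B : choiceType) (x : {malg K[A]}) (y : {malg K[B]})
  : {malg K[(A * B)%type]} :=
  \sum_(a <- msupp x) \sum_(b <- msupp y) << (x@_a * y@_b) *g (a, b) >>.

(* basis vector of a family of subsets (it is always a topology when used) *)
Definition bas (m : nat) (S : {set {set 'I_m}}) : H :=
  if insub S is Some t then << (Tagged topo t : Topo) >> else 0.

Definition oneH : H := bas [set (set0 : {set 'I_0})].

Definition deltaB (t : Topo) : HH :=
  \sum_(O in val (tagged t))
     tens (bas (std_restr (val (tagged t)) (~: O)))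
          (bas (std_restr (val (tagged t)) O)).

Definition deltaH (x : H) : HH := lin_ext deltaB x.

Definition epsH (x : H) : K := \sum_(t <- msupp x | tag t == 0%N) x@_t.

Definition primitive (x : H) : bool := deltaH x == tens x oneH + tens oneH x.

Definition conc (x : H) (y : TH) : TH :=
  \sum_(a <- msupp x) \sum_(w <- msupp y) << (x@_a * y@_w) *g (a :: w) >>.
Definition tword (s : seq H) : TH := foldr conc << [::] >> s.

(* T(Prim H_T), as the subspace of T(H_T) spanned by the tensors
   p_1 (x) ... (x) p_k of primitive elements *)
Definition in_TPrim (y : TH) : Prop :=
  exists l : seq (K * seq H),
    all (fun p => all primitive p.2) l /\ y = \sum_(p <- l) p.1 *: tword p.2.

Definition deltaT (y : TH) : TT :=
  lin_ext (fun w : seq Topo =>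
    \sum_(i < (size w).+1) << (take i w, drop i w) >> : TT) y.
Definition epsT (y : TH) : K := y@_[::].

Definition tensmap (phi : H -> TH) (z : HH) : TT :=
  lin_ext (fun ab : Topo * Topo => tens (phi << ab.1 >>) (phi << ab.2 >>)) z.

End Coalg.

(* Main.v *)
(* Besides the coproduct, topologies carry an associative product: in [T] followed by [S],
   written [starT], the open sets are those of [S] (with no point of [T]) and those of [T]
   joined with all of [S].  It makes H_T a unital infinitesimal bialgebra:
   Delta(x * y) = x' (x) x'' * y + x * y' (x) y'' - x (x) y.
   For the convolution product that [*] and Delta define on linear endomorphisms, the
   identity is invertible; if its inverse is written eta eps - e, then the map e [projP]
   is a projection of H_T onto its primitive elements.  The isomorphism is
   phi = eta eps + sum_k e^(x)k o Delta^(k-1), with inverse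
   p_1 (x) ... (x) p_k |-> p_1 * ... * p_k. *)
Require Import Defs.
From HB Require Import structures.
From mathcomp Require Import all_boot all_order all_algebra.
From mathcomp Require Import finmap.
From mathcomp.multinomials Require Import monalg.
Local Open Scope ring_scope.

Set Implicit Arguments.
Unset Strict Implicit.
Unset Printing Implicit Defensive.
Import GRing.Theory.

(** * Restriction and composition of topologies *)

(** For primitive [x] the infinitesimal relation reduces to: the coproduct of [x * s] is
    [1 (x) x * s] plus the sum of the [x * s' (x) s'']. Deconcatenation treats a word with [x]
    prepended in the same way, so left multiplication by a primitive should correspond to adding a
    first letter. Injectivity then rests on the convolution identity defining e, and surjectivity on
    e(x * s) = eps(s) x for primitive [x]. Both are inductions on the degree, possible because
    degree 0 contains only the unit. On the side of topologies the obstacle is renumbering: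
    restrictions live on ['I_#|Y|], and cardinals that agree need not be convertible. Restriction to
    [Y] is therefore treated as pullback along any increasing map with image [Y]; such a map is
    unique, so ranks and casts hardly appear. *)

Definition ord_incr m n (f : 'I_m -> 'I_n) := {homo f : i j / (i < j)%N}.

Lemma ord_incr_mono m n (f : 'I_m -> 'I_n) :
  ord_incr f -> {mono f : i j / (i < j)%N}.
Proof.
move=> fi i j; case: (ltngtP i j) => [/fi // | /fi h | /val_inj ->].
  by apply/negbTE; rewrite -leqNgt ltnW.
by rewrite ltnn.
Qed.

Lemma ord_incr_inj m n (f : 'I_m -> 'I_n) : ord_incr f -> injective f.
Proof.
move=> fi i j eq_f; apply: val_inj; case: (ltngtP i j) => // /fi;
by rewrite eq_f ltnn.
Qed.

Lemma ord_incr_comp m n p (f : 'I_m -> 'I_n) (g : 'I_p -> 'I_m) :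
  ord_incr f -> ord_incr g -> ord_incr (f \o g).
Proof. by move=> fi gi i j /gi /fi. Qed.

(** The points of the image below [f k] are the images of the [k] indices below [k]. This links the
    ranks in the definition of Std to increasing maps, and makes an increasing map recoverable from
    its image. *)
Lemma rank_in_incr m n (f : 'I_m -> 'I_n) (k : 'I_m) :
  ord_incr f -> rank_in (f @: setT) (f k) = k.
Proof.
move=> fi; rewrite /rank_in.
have -> : [set j in f @: setT | (j < f k)%N] = f @: [set l : 'I_m | (l < k)%N].
  apply/setP=> j; rewrite inE; apply/andP/imsetP => [[/imsetP[l _ ->]]|[l]].
    by rewrite ord_incr_mono // => lk; exists l; rewrite ?inE.
  by rewrite inE => lk ->; rewrite imset_f ?inE // ord_incr_mono.
rewrite (card_imset _ (ord_incr_inj fi)).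
have le_km : (k <= m)%N by rewrite ltnW.
have -> : [set l : 'I_m | (l < k)%N] = widen_ord le_km @: setT.
  apply/setP=> l; rewrite inE; apply/idP/imsetP => [lk|[i _ ->]]; last exact: (ltn_ord i).
  by exists (Ordinal lk); rewrite ?inE //; apply: val_inj.
by rewrite card_imset ?cardsT ?card_ord // => i j [] ij; exact: val_inj.
Qed.

Lemma ord_incr_uniq m n (f f' : 'I_m -> 'I_n) :
  ord_incr f -> ord_incr f' -> f @: setT = f' @: setT -> f =1 f'.
Proof.
move=> fi fi' im_eq k.
have /imsetP[l _ fkl] : f k \in f' @: setT by rewrite -im_eq imset_f ?inE.
rewrite fkl; congr f'; apply: val_inj; have := rank_in_incr l fi'.
by rewrite -fkl -im_eq rank_in_incr.
Qed.

Lemma enum_val_incr n (Y : {set 'I_n}) : ord_incr (@enum_val _ (mem Y)).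
Proof.
move=> i j ij; have x0 := enum_val i.
rewrite !(enum_val_nth x0).
have sortedY : sorted ltn [seq val i | i <- enum Y].
  rewrite sorted_map sorted_filter //; first by move=> ? ? ?; apply: ltn_trans.
  by rewrite -sorted_map -enumT val_enum_ord iota_ltn_sorted.
have := sorted_ltn_nth ltn_trans 0%N sortedY i j; rewrite !inE size_map -cardE.
move=> /(_ (ltn_ord _) (ltn_ord _) ij).
by rewrite !(nth_map x0) // -cardE.
Qed.

Lemma imset_enum_val n (Y : {set 'I_n}) (A : {set 'I_n}) :
  @enum_val _ (mem Y) @: (@enum_val _ (mem Y) @^-1: A) = Y :&: A.
Proof.
apply/setP=> i; rewrite inE; apply/imsetP/andP => [[k]|[iY iA]].
  by rewrite inE => kA ->; split=> //; apply: enum_valP.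
by exists (enum_rank_in iY i); rewrite ?inE enum_rankK_in.
Qed.

Lemma imset_enum_valT n (Y : {set 'I_n}) : @enum_val _ (mem Y) @: setT = Y.
Proof. by rewrite -(preimsetT (@enum_val _ (mem Y))) imset_enum_val setIT. Qed.

(** The rank of a point of [Y] is its index in the increasing enumeration of [Y], so standardising
    is taking a preimage; from here on no rank is computed. *)
Lemma std_openE n (Y O : {set 'I_n}) : std_open Y O = @enum_val _ (mem Y) @^-1: O.
Proof.
apply/setP=> k; rewrite !inE; apply/existsP/idP => [[i]|kO].
  rewrite inE -andbA => /and3P[iO iY /eqP rk].
  suff <- : i = enum_val k by [].
  rewrite -(enum_rankK_in iY iY); congr enum_val; apply: val_inj.
  have := rank_in_incr (enum_rank_in iY i) (@enum_val_incr n Y).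
  by rewrite imset_enum_valT enum_rankK_in // rk.
exists (enum_val k); rewrite inE kO enum_valP /=; apply/eqP.
by rewrite -[X in rank_in X _]imset_enum_valT rank_in_incr //; apply: enum_val_incr.
Qed.

Lemma is_topologyP n (T : {set {set 'I_n}}) :
  reflect [/\ set0 \in T, setT \in T &
    forall A B, A \in T -> B \in T -> A :|: B \in T /\ A :&: B \in T]
   (is_topology T).
Proof.
apply: (iffP and3P) => -[h0 h1 h2]; split=> //.
  by move=> A B AT BT; apply/andP; move/forall_inP/(_ _ AT)/forall_inP: h2; apply.
by apply/forall_inP=> A AT; apply/forall_inP=> B BT; apply/andP; apply: h2.
Qed.

Section Topo.

Variables (n : nat) (T : topo n).

Lemma topo0 : set0 \in val T.
Proof. by case/is_topologyP: (valP T). Qed.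

Lemma topoT : setT \in val T.
Proof. by case/is_topologyP: (valP T). Qed.

Lemma topoU A B : A \in val T -> B \in val T -> A :|: B \in val T.
Proof. by case/is_topologyP: (valP T) => _ _ h /h{}h /h[]. Qed.

Lemma topoI A B : A \in val T -> B \in val T -> A :&: B \in val T.
Proof. by case/is_topologyP: (valP T) => _ _ h /h{}h /h[]. Qed.

Lemma pull_topology m (f : 'I_m -> 'I_n) :
  is_topology [set f @^-1: O | O : {set 'I_n} in val T].
Proof.
apply/is_topologyP; split.
- by apply/imsetP; exists set0; rewrite ?topo0 ?preimset0.
- by apply/imsetP; exists setT; rewrite ?topoT ?preimsetT.
move=> _ _ /imsetP[A AT ->] /imsetP[B BT ->].
by rewrite -preimsetU -preimsetI; split; apply: imset_f; [apply: topoU | apply: topoI].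
Qed.

Definition pull m (f : 'I_m -> 'I_n) : topo m := exist (@is_topology m) _ (pull_topology f).

Definition restr (Y : {set 'I_n}) : Topo := Tagged topo (pull (@enum_val _ (mem Y))).

End Topo.

Lemma pullE m n (T : topo n) (f : 'I_m -> 'I_n) :
  val (pull T f) = [set f @^-1: O | O : {set 'I_n} in val T].
Proof. by []. Qed.

Lemma pull_comp m n p (T : topo n) (f : 'I_m -> 'I_n) (g : 'I_p -> 'I_m) :
  pull (pull T f) g = pull T (f \o g).
Proof.
apply: val_inj; rewrite !pullE -imset_comp.
by apply: eq_imset => O /=; apply/setP=> i; rewrite !inE.
Qed.

Lemma pull_id n (T : topo n) : pull T id = T.
Proof.
apply: val_inj; rewrite pullE -[RHS]imset_id.
by apply: eq_imset => O /=; apply/setP=> i; rewrite !inE.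
Qed.

(** Only the image of an increasing map matters. Iterated restrictions and restrictions of products
    are all computed by choosing a convenient [f] here. *)
Lemma restrE m n (T : topo n) (f : 'I_m -> 'I_n) :
  ord_incr f -> restr T (f @: setT) = Tagged topo (pull T f).
Proof.
move=> fi; rewrite /restr; set Y := f @: setT.
have im_eq : @enum_val _ (mem Y) @: setT = f @: setT by exact: imset_enum_valT.
have gi := @enum_val_incr n Y.
(* The type of [enum_val] mentions [#|Y|]. Abstracting it, with only its image and monotonicity
   retained, allows [#|Y|] to be replaced by [m]. *)
move: (enum_val (A:=_)) im_eq gi.
have -> : #|Y| = m by rewrite /Y card_imset ?cardsT ?card_ord //; exact: ord_incr_inj.
move=> g im_eq gi; congr Tagged; apply: val_inj; rewrite !pullE.
apply: eq_imset => O; apply/setP=> i.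
by rewrite !inE (ord_incr_uniq gi fi im_eq).
Qed.

Lemma restrT n (T : topo n) : restr T setT = Tagged topo T.
Proof.
have <- : id @: setT = [set: 'I_n] by rewrite imset_id.
by rewrite restrE ?pull_id.
Qed.

(** The inner subset is given by a set [A] of the ambient space, so that transitivity of restriction
    needs no renumbering. *)
Lemma restr_restr n (T : topo n) (Y : {set 'I_n}) (A : {set 'I_n}) :
  restr (tagged (restr T Y)) (@enum_val _ (mem Y) @^-1: A) = restr T (Y :&: A).
Proof.
rewrite /restr /= pull_comp -restrE; last first.
  by apply: ord_incr_comp; apply: enum_val_incr.
by congr (restr T _); rewrite imset_comp imset_enum_valT imset_enum_val.
Qed.

Lemma one_topology : is_topology [set (set0 : {set 'I_0})].
Proof.
apply/is_topologyP; split; rewrite ?inE //; first by apply/eqP/setP=> -[].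
by move=> A B /set1P -> /set1P ->; rewrite setU0 setI0 inE.
Qed.

Definition oneT : Topo := Tagged topo (exist (@is_topology 0) _ one_topology).

Lemma topo_ord0 (t : Topo) : tag t = 0%N -> t = oneT.
Proof.
case: t => n T /= n0; subst n; congr Tagged; apply: val_inj; apply/setP=> A /=.
have -> : A = set0 by apply/setP=> -[].
by rewrite inE eqxx topo0.
Qed.

Lemma tag_restr n (T : topo n) Y : tag (restr T Y) = #|Y|.
Proof. by []. Qed.

Lemma restr0 n (T : topo n) : restr T set0 = oneT.
Proof. by apply: topo_ord0; rewrite tag_restr cards0. Qed.

(** * The product of two topologies and its open sets *)

Section Join.
Variables m n : nat.

Definition joinS (A : {set 'I_m}) (B : {set 'I_n}) : {set 'I_(m + n)} :=
  [set i | match split i with inl j => j \in A | inr j => j \in B end].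

Lemma joinS_l A B i : (lshift n i \in joinS A B) = (i \in A).
Proof. by rewrite inE (unsplitK (inl _ i)). Qed.

Lemma joinS_r A B i : (rshift m i \in joinS A B) = (i \in B).
Proof. by rewrite inE (unsplitK (inr _ i)). Qed.

Lemma setP_split (U V : {set 'I_(m + n)}) :
  (forall i, (lshift n i \in U) = (lshift n i \in V)) ->
  (forall i, (rshift m i \in U) = (rshift m i \in V)) -> U = V.
Proof. by move=> hl hr; apply/setP=> i; case: (split_ordP i) => j ->. Qed.

Lemma setC_joinS A B : ~: joinS A B = joinS (~: A) (~: B).
Proof.
by apply: setP_split => i; rewrite !(inE, unsplitK (inl _ i), unsplitK (inr _ i)).
Qed.

Lemma setU_joinS A B C D : joinS A B :|: joinS C D = joinS (A :|: C) (B :|: D).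
Proof. by apply: setP_split => i; rewrite in_setU !(joinS_l, joinS_r) in_setU. Qed.

Lemma setI_joinS A B C D : joinS A B :&: joinS C D = joinS (A :&: C) (B :&: D).
Proof. by apply: setP_split => i; rewrite in_setI !(joinS_l, joinS_r) in_setI. Qed.

Lemma joinS_inj A B C D : joinS A B = joinS C D -> A = C /\ B = D.
Proof.
move=> /setP eqJ; split; apply/setP=> i.
  by have := eqJ (lshift n i); rewrite !joinS_l.
by have := eqJ (rshift m i); rewrite !joinS_r.
Qed.

Lemma joinS00 : joinS set0 set0 = set0.
Proof. by apply: setP_split => i; rewrite !(joinS_l, joinS_r) !inE. Qed.

Lemma joinSTT : joinS setT setT = setT.
Proof. by apply: setP_split => i; rewrite !(joinS_l, joinS_r) !inE. Qed.

Lemma ord_incr_lshift : ord_incr (@lshift m n).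
Proof. by []. Qed.

Lemma ord_incr_rshift : ord_incr (@rshift m n).
Proof. by move=> i j; rewrite /= ltn_add2l. Qed.

Lemma imset_lshift (A : {set 'I_m}) : @lshift m n @: A = joinS A set0.
Proof.
apply: setP_split => i; rewrite ?joinS_l ?joinS_r.
  by rewrite mem_imset //; exact: lshift_inj.
by rewrite inE; apply/negbTE/imsetP=> -[j _ /eqP]; rewrite eq_rlshift.
Qed.

Lemma imset_rshift (A : {set 'I_n}) : @rshift m n @: A = joinS set0 A.
Proof.
apply: setP_split => i; rewrite ?joinS_l ?joinS_r.
  by rewrite inE; apply/negbTE/imsetP=> -[j _ /eqP]; rewrite eq_lrshift.
by rewrite mem_imset //; exact: rshift_inj.
Qed.

Variables (T : topo m) (S : topo n).

Definition star_opens : {set {set 'I_(m + n)}} :=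
  [set joinS A setT | A : {set 'I_m} in val T] :|:
  [set joinS set0 B | B : {set 'I_n} in val S].

Lemma star_opensP U :
  reflect ((exists2 A, A \in val T & U = joinS A setT) \/
           (exists2 B, B \in val S & U = joinS set0 B))
    (U \in star_opens).
Proof.
rewrite in_setU; apply: (iffP orP) => -[].
- by move/imsetP; left.
- by move/imsetP; right.
- by move=> h; left; apply/imsetP.
- by move=> h; right; apply/imsetP.
Qed.

Lemma star_topology : is_topology star_opens.
Proof.
apply/is_topologyP; split.
- by apply/star_opensP; right; exists set0; rewrite ?topo0 ?joinS00.
- by apply/star_opensP; left; exists setT; rewrite ?topoT ?joinSTT.
move=> U V /star_opensP[] [A AT ->] /star_opensP[] [B BT ->];
  rewrite setU_joinS setI_joinS; split; apply/star_opensP;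
  rewrite ?setTU ?setUT ?setTI ?setIT ?set0U ?setU0 ?set0I ?setI0.
- by left; exists (A :|: B); rewrite ?topoU.
- by left; exists (A :&: B); rewrite ?topoI.
- by left; exists A.
- by right; exists B.
- by left; exists B.
- by right; exists A.
- by right; exists (A :|: B); rewrite ?topoU.
- by right; exists (A :&: B); rewrite ?topoI.
Qed.

Definition star_topo : topo (m + n) := exist (@is_topology (m + n)) _ star_topology.

Lemma pull_star_lshift : pull star_topo (lshift n) = T.
Proof.
have preim_l A B : lshift n @^-1: joinS A B = A.
  by apply/setP=> i; rewrite inE joinS_l.
apply: val_inj; apply/setP=> A; rewrite pullE; apply/imsetP/idP.
  by move=> [_ /star_opensP[] [B BT ->] ->]; rewrite preim_l ?topo0.
by move=> AT; exists (joinS A setT); rewrite ?preim_l //; apply/star_opensP; left; exists A.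
Qed.

Lemma pull_star_rshift : pull star_topo (@rshift m n) = S.
Proof.
have preim_r A B : @rshift m n @^-1: joinS A B = B.
  by apply/setP=> i; rewrite inE joinS_r.
apply: val_inj; apply/setP=> A; rewrite pullE; apply/imsetP/idP.
  by move=> [_ /star_opensP[] [B BT ->] ->]; rewrite preim_r ?topoT.
move=> AT; exists (joinS set0 A); rewrite ?preim_r //.
by apply/star_opensP; right; exists A.
Qed.

Lemma restr_star_l A : restr star_topo (joinS A set0) = restr T A.
Proof.
rewrite -imset_lshift -[A in LHS]imset_enum_valT -imset_comp restrE.
  by rewrite -pull_comp pull_star_lshift.
by apply: ord_incr_comp; [exact: ord_incr_lshift | exact: enum_val_incr].
Qed.

Lemma restr_star_r A : restr star_topo (joinS set0 A) = restr S A.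
Proof.
rewrite -imset_rshift -[A in LHS]imset_enum_valT -imset_comp restrE.
  by rewrite -pull_comp pull_star_rshift.
by apply: ord_incr_comp; [exact: ord_incr_rshift | exact: enum_val_incr].
Qed.

(** The two families of open sets meet only in [joinS set0 setT], which is counted twice. This is
    the origin of the negative term in the infinitesimal relation. *)
Lemma big_star (V : zmodType) (F : {set 'I_(m + n)} -> V) :
  \sum_(U in val star_topo) F U =
    \sum_(A in val T) F (joinS A setT) + \sum_(B in val S) F (joinS set0 B)
    - F (joinS set0 setT).
Proof.
have -> : val star_topo = [set joinS A setT | A : {set 'I_m} in val T] :|:
            [set joinS set0 B | B : {set 'I_n} in val S :\ setT].
  apply/setP=> U; apply/star_opensP/idP.
    move=> [] [A AT ->]; rewrite in_setU; apply/orP.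
      by left; apply/imsetP; exists A.
    have [->|AnT] := eqVneq A setT; first by left; apply/imsetP; exists set0; rewrite ?topo0.
    by right; apply/imsetP; exists A; rewrite // !inE AnT.
  move=> /setUP[] /imsetP[A AT ->]; first by left; exists A.
  by right; exists A => //; case/setD1P: AT.
rewrite (eq_bigl _ _ (fun U => in_setU U _ _)) bigU /=; last first.
  rewrite -setI_eq0; apply/eqP/setP=> U; rewrite in_setI in_set0; apply/negbTE/negP.
  move=> /andP[/imsetP[A AT ->] /imsetP[B BS /joinS_inj[_ BT]]].
  by move: BS; rewrite -BT !inE eqxx.
rewrite !big_imset /=; first last.
- by move=> A B _ _ /joinS_inj[].
- by move=> A B _ _ /joinS_inj[].
by rewrite (big_setD1 _ (topoT S)) /= [F _ + _]addrC addrA addrK.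
Qed.

End Join.

Section PullStar.
Variables (m n m' n' : nat) (f : 'I_m' -> 'I_m) (g : 'I_n' -> 'I_n).

Definition sum_ord (i : 'I_(m' + n')) : 'I_(m + n) :=
  match split i with inl j => lshift n (f j) | inr j => rshift m (g j) end.

Lemma sum_ord_l i : sum_ord (lshift n' i) = lshift n (f i).
Proof. by rewrite /sum_ord (unsplitK (inl _ i)). Qed.

Lemma sum_ord_r i : sum_ord (rshift m' i) = rshift m (g i).
Proof. by rewrite /sum_ord (unsplitK (inr _ i)). Qed.

Lemma sum_ord_incr : ord_incr f -> ord_incr g -> ord_incr sum_ord.
Proof.
move=> fi gi i j.
case: (split_ordP i) => i' ->; case: (split_ordP j) => j' ->;
  rewrite ?sum_ord_l ?sum_ord_r /= ?ltn_add2l => ij.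
- exact: fi.
- by rewrite (leq_trans (ltn_ord _)) ?leq_addr.
- by move: ij; rewrite ltnNge ltnW // (leq_trans (ltn_ord _)) ?leq_addr.
- exact: gi.
Qed.

Lemma preim_sum_ord A B : sum_ord @^-1: joinS A B = joinS (f @^-1: A) (g @^-1: B).
Proof.
by apply: setP_split => i; rewrite inE ?sum_ord_l ?sum_ord_r ?joinS_l ?joinS_r inE.
Qed.

Lemma imset_sum_ord A B : sum_ord @: joinS A B = joinS (f @: A) (g @: B).
Proof.
apply: setP_split => i; rewrite ?joinS_l ?joinS_r; apply/imsetP/imsetP.
- move=> [k]; case: (split_ordP k) => k' -> {k};
    rewrite ?sum_ord_l ?sum_ord_r ?joinS_l ?joinS_r => kA /eqP.
    by rewrite eq_lshift => /eqP ->; exists k'.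
  by rewrite eq_lrshift.
- by move=> [k kA ->]; exists (lshift n' k); rewrite ?joinS_l ?sum_ord_l.
- move=> [k]; case: (split_ordP k) => k' -> {k};
    rewrite ?sum_ord_l ?sum_ord_r ?joinS_l ?joinS_r => kA /eqP.
    by rewrite eq_rlshift.
  by rewrite eq_rshift => /eqP ->; exists k'.
- by move=> [k kA ->]; exists (rshift m' k); rewrite ?joinS_r ?sum_ord_r.
Qed.

(** Preimages under a block map act separately on each block, and they preserve the full and the
    empty block that characterise the open sets of a product. *)
Lemma pull_star (T : topo m) (S : topo n) :
  pull (star_topo T S) sum_ord = star_topo (pull T f) (pull S g).
Proof.
apply: val_inj; apply/setP=> U; apply/imsetP/star_opensP.
  move=> [_ /star_opensP[] [A AT ->] ->]; rewrite preim_sum_ord.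
    by left; exists (f @^-1: A); rewrite ?preimsetT //; apply: imset_f.
  by right; exists (g @^-1: A); rewrite ?preimset0 //; apply: imset_f.
move=> [] [_ /imsetP[A AT ->] ->].
  exists (joinS A setT); rewrite ?preim_sum_ord ?preimsetT //.
  by apply/star_opensP; left; exists A.
exists (joinS set0 A); rewrite ?preim_sum_ord ?preimset0 //.
by apply/star_opensP; right; exists A.
Qed.

End PullStar.

Definition starT (t s : Topo) : Topo :=
  Tagged topo (star_topo (tagged t) (tagged s)).

Lemma restr_star m n (T : topo m) (S : topo n) A B :
  restr (star_topo T S) (joinS A B) = starT (restr T A) (restr S B).
Proof.
rewrite -[A in LHS]imset_enum_valT -[B in LHS]imset_enum_valT -imset_sum_ord joinSTT.
rewrite restrE ?pull_star //.
by apply: sum_ord_incr; exact: enum_val_incr.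
Qed.

Lemma starT_oner (t : Topo) : starT t oneT = t.
Proof.
case: t => n T; rewrite /starT /= -restrT -joinSTT.
(* On ['I_0] the full set is empty, so the product becomes a restriction to its left block. This
   compares topologies on [n + 0] and [n] points without a cast. *)
have -> : [set: 'I_0] = set0 by apply/setP=> -[].
by rewrite restr_star_l restrT.
Qed.

Lemma starT_onel (t : Topo) : starT oneT t = t.
Proof.
case: t => n T; rewrite /starT /= -restrT -joinSTT.
have -> : [set: 'I_0] = set0 by apply/setP=> -[].
by rewrite restr_star_r restrT.
Qed.

(** The coproduct of a basis element as a list of pairs, repetitions included. Identities can then
    be stated for sums of an arbitrary [F] over this list, with no iterated tensor products. *)
Definition cutsT (t : Topo) : seq (Topo * Topo) :=
  [seq (restr (tagged t) (~: A), restr (tagged t) A)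
     | A : {set 'I_(tag t)} <- enum (val (tagged t))].

Lemma tag_cutsT (t : Topo) (p : Topo * Topo) :
  p \in cutsT t -> (tag p.1 + tag p.2)%N = tag t.
Proof.
case: t => n T /mapP[A _ ->]; rewrite !tag_restr addnC.
by rewrite -[LHS]/(#|A| + #|~: A|)%N cardsC card_ord.
Qed.

Section Cuts.
Variable V : zmodType.

Lemma big_cutsT_cond n (T : topo n) (F : Topo * Topo -> V) (P : pred (Topo * Topo)) :
  \sum_(p <- cutsT (Tagged topo T) | P p) F p =
  \sum_(O in val T | P (restr T (~: O), restr T O)) F (restr T (~: O), restr T O).
Proof. by rewrite big_map big_enum_cond. Qed.

Lemma big_cutsT n (T : topo n) (F : Topo * Topo -> V) :
  \sum_(p <- cutsT (Tagged topo T)) F p =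
  \sum_(O in val T) F (restr T (~: O), restr T O).
Proof. by rewrite big_cutsT_cond; apply: eq_bigl => O; rewrite andbT. Qed.

Lemma cutsT_counitr t (F : Topo * Topo -> V) :
  \sum_(p <- cutsT t) F p = F (t, oneT) + \sum_(p <- cutsT t | tag p.2 != 0%N) F p.
Proof.
case: t => n T; rewrite big_cutsT big_cutsT_cond (bigD1 set0) ?topo0 //=.
rewrite setC0 restrT restr0; congr (_ + _); apply: eq_bigl => O.
by rewrite /= cards_eq0.
Qed.

Lemma cutsT_counitl t (F : Topo * Topo -> V) :
  \sum_(p <- cutsT t) F p = F (oneT, t) + \sum_(p <- cutsT t | tag p.1 != 0%N) F p.
Proof.
case: t => n T; rewrite big_cutsT big_cutsT_cond (bigD1 setT) ?topoT //=.
rewrite setCT restrT restr0; congr (_ + _); apply: eq_bigl => O.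
by rewrite /= cards_eq0 -setCT (inj_eq (@setC_inj _)).
Qed.

(** Both sides enumerate the pairs of open sets [P \subset O], cutting the space into the complement
    of [O], the difference of [O] and [P], and [P]. *)
Lemma cutsT_coassoc t (F : Topo -> Topo -> Topo -> V) :
  \sum_(p <- cutsT t) \sum_(q <- cutsT p.2) F p.1 q.1 q.2 =
  \sum_(p <- cutsT t) \sum_(q <- cutsT p.1) F q.1 q.2 p.2.
Proof.
case: t => n T; rewrite !big_cutsT /=.
transitivity (\sum_(O in val T) \sum_(P in val T | P \subset O)
   F (restr T (~: O)) (restr T (O :&: ~: P)) (restr T P)).
  apply: eq_bigr => O OT; rewrite big_cutsT.
  (* As [O] is open, each open set of the restriction to [O] is the trace of exactly one open set
     inside [O]: a representative [P] is replaced by [O :&: P]. *)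
  have -> : val (pull T (@enum_val _ (mem O))) =
      [set @enum_val _ (mem O) @^-1: P | P : {set 'I_n} in
         [set P in val T | P \subset O]].
    rewrite pullE; apply/setP=> Z; apply/imsetP/imsetP => -[P].
      move=> PT ->; exists (O :&: P); rewrite ?inE ?topoI ?subsetIl //.
      by apply/setP=> i; rewrite !inE enum_valP.
    by rewrite inE => /andP[PT _] ->; exists P.
  rewrite big_imset /=; last first.
    move=> P Q; rewrite !inE => /andP[_ /setIidPr PO] /andP[_ /setIidPr QO] eqPQ.
    by rewrite -PO -QO -!imset_enum_val eqPQ.
  rewrite big_set; apply: eq_bigr => P /andP[_ PO].
  rewrite -preimsetC !(@restr_restr _ T O).
  by rewrite (setIidPr PO).
transitivity (\sum_(P in val T) \sum_(O in val T | P \subset O)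
   F (restr T (~: O)) (restr T (O :&: ~: P)) (restr T P)).
  rewrite (exchange_big_dep (fun P => P \in val T)) /=; last by move=> ? ? _ /andP[].
  by apply: eq_bigr => P PT; apply: eq_bigl => O; rewrite PT.
apply: eq_bigr => P PT; rewrite big_cutsT.
(* Dually, an open set of the restriction to [~: P] is the trace of exactly one open set containing
   [P]: a representative [O] is replaced by [P :|: O]. *)
have -> : val (pull T (@enum_val _ (mem (~: P)))) =
    [set @enum_val _ (mem (~: P)) @^-1: O | O : {set 'I_n} in
       [set O in val T | P \subset O]].
  rewrite pullE; apply/setP=> Z; apply/imsetP/imsetP => -[O].
    move=> OT ->; exists (P :|: O); rewrite ?inE ?topoU ?subsetUl //.
    apply/setP=> i; rewrite !inE.
    by have := enum_valP i; rewrite !inE => /negbTE ->.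
  by rewrite inE => /andP[OT _] ->; exists O.
rewrite big_imset /=; last first.
  move=> O Q; rewrite !inE => /andP[_ PO] /andP[_ PQ] eqOQ.
  have eqC : ~: P :&: O = ~: P :&: Q by rewrite -!imset_enum_val eqOQ.
  apply/setP=> i; have [iP|iP] := boolP (i \in P).
    by rewrite (subsetP PO) // (subsetP PQ).
  by move/setP/(_ i): eqC; rewrite !inE iP.
rewrite big_set; apply: eq_bigr => O /andP[_ PO].
rewrite -preimsetC !(@restr_restr _ T (~: P)).
by rewrite -setCU (setUidPr PO) setIC.
Qed.

Lemma cutsT_starT t s (F : Topo * Topo -> V) :
  \sum_(p <- cutsT (starT t s)) F p =
  \sum_(p <- cutsT t) F (p.1, starT p.2 s) + \sum_(p <- cutsT s) F (starT t p.1, p.2)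
  - F (t, s).
Proof.
case: t s => m T [n S]; rewrite !big_cutsT big_star.
congr (_ + _ - _).
- apply: eq_bigr => A _.
  by rewrite setC_joinS setCT restr_star_l restr_star restrT.
- apply: eq_bigr => B _.
  by rewrite setC_joinS setC0 restr_star_r restr_star restrT.
by rewrite setC_joinS setC0 setCT restr_star_l restr_star_r !restrT.
Qed.

End Cuts.

(** * Linear extensions *)

Section LinExt.
Variables (K : fieldType) (A : choiceType) (V : lmodType K).

Lemma lin_extEw (f : A -> V) (g : {malg K[A]}) (d : {fset A}) :
  (msupp g `<=` d)%fset -> lin_ext f g = \sum_(a <- d) g@_a *: f a.
Proof.
move=> gd; rewrite /lin_ext (big_fset_incl _ gd) // => a _ /mcoeff_outdom ->.
by rewrite scale0r.
Qed.

Lemma lin_ext_linear (f : A -> V) : linear (lin_ext f).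
Proof.
move=> c u v; set d := (msupp u `|` msupp v `|` msupp (c *: u + v))%fset.
rewrite !(@lin_extEw f _ d) /d; first last.
- by rewrite fsubsetUr.
- by rewrite -fsetUA fsubsetUl.
- by rewrite fsetUAC fsubsetUr.
rewrite scaler_sumr -big_split /=; apply: eq_bigr => a _.
by rewrite mcoeffD mcoeffZ scalerDl scalerA.
Qed.

HB.instance Definition _ (f : A -> V) :=
  GRing.isLinear.Build K {malg K[A]} V *:%R (lin_ext f) (lin_ext_linear f).

Lemma lin_extU (f : A -> V) a : lin_ext f << a >> = f a.
Proof.
by rewrite (@lin_extEw f _ [fset a]%fset) ?msuppU_le // big_seq_fset1 mcoeffUU scale1r.
Qed.

Lemma malgE_sum (x : {malg K[A]}) : x = \sum_(a <- msupp x) x@_a *: << a >>.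
Proof.
rewrite {1}[x]monalgE; apply: eq_bigr => a _; apply/malgP=> b.
by rewrite mcoeffZ !mcoeffU mulr_natr.
Qed.

(** Plain functions with linearity proofs are accepted, so both sides may be arbitrary expressions
    in [x]; the morphism structures are built inside. *)
Lemma linear_ext_eq (f g : {malg K[A]} -> V) :
  linear f -> linear g -> (forall a, f << a >> = g << a >>) -> f =1 g.
Proof.
move=> fl gl fg x.
pose F := HB.pack_for {linear {malg K[A]} -> V} f (GRing.isLinear.Build _ _ _ _ f fl).
pose G := HB.pack_for {linear {malg K[A]} -> V} g (GRing.isLinear.Build _ _ _ _ g gl).
rewrite -[f x]/(F x) -[g x]/(G x) [x]malgE_sum !linear_sum.
by apply: eq_bigr => a _; rewrite !linearZ /= fg.
Qed.

End LinExt.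

Section Bilinear.
Variables (K : fieldType) (A B : choiceType) (V : lmodType K).
Implicit Types (F : A -> B -> V) (x : {malg K[A]}) (y : {malg K[B]}).

Definition bilin_ext F x y := lin_ext (fun a => lin_ext (F a) y) x.

Lemma bilin_extE F x y : bilin_ext F x y =
  \sum_(a <- msupp x) \sum_(b <- msupp y) (x@_a * y@_b) *: F a b.
Proof.
apply: eq_bigr => a _; rewrite scaler_sumr; apply: eq_bigr => b _.
by rewrite scalerA.
Qed.

Lemma bilin_ext_linearl F y : linear (bilin_ext F ^~ y).
Proof. exact: lin_ext_linear. Qed.

Lemma bilin_ext_linearr F x : linear (bilin_ext F x).
Proof.
move=> c u v; rewrite scaler_sumr -big_split /=; apply: eq_bigr => a _.
by rewrite linearP scalerDr !scalerA mulrC.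
Qed.

Lemma bilin_extU F a b : bilin_ext F << a >> << b >> = F a b.
Proof. by rewrite /bilin_ext !lin_extU. Qed.

HB.instance Definition _ F x :=
  GRing.isLinear.Build K {malg K[B]} V *:%R (bilin_ext F x) (bilin_ext_linearr F x).

End Bilinear.

Section LinearClosure.
Variables (K : fieldType) (U V W : lmodType K).

Lemma linear_comp_fun (f : V -> W) (g : U -> V) :
  linear f -> linear g -> linear (fun x => f (g x)).
Proof. by move=> fl gl c u v; rewrite gl fl. Qed.

Lemma linear_add_fun (f g : U -> V) :
  linear f -> linear g -> linear (fun x => f x + g x).
Proof. by move=> fl gl c u v; rewrite fl gl scalerDr addrACA. Qed.

Lemma linear_sub_fun (f g : U -> V) :
  linear f -> linear g -> linear (fun x => f x - g x).
Proof. by move=> fl gl c u v; rewrite fl gl scalerBr opprD addrACA. Qed.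

Lemma linear_sum_fun (I : Type) (r : seq I) (f : I -> U -> V) :
  (forall i, linear (f i)) -> linear (fun x => \sum_(i <- r) f i x).
Proof.
move=> fl c u v; rewrite scaler_sumr -big_split /=.
by apply: eq_bigr => i _; apply: fl.
Qed.

End LinearClosure.

Section Tensor.
Variable K : fieldType.

Lemma tensE (A B : choiceType) (x : {malg K[A]}) (y : {malg K[B]}) :
  tens x y = bilin_ext (fun a b => << (a, b) >> : {malg K[(A * B)%type]}) x y.
Proof.
rewrite bilin_extE; apply: eq_bigr => a _; apply: eq_bigr => b _.
by apply/malgP=> c; rewrite mcoeffZ !mcoeffU mulr_natr.
Qed.

Section TensorLinear.
Variables (A B : choiceType).
Implicit Types (u v : {malg K[A]}) (x y : {malg K[B]}).

Lemma tens_linearl y : linear (fun u => tens u y).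
Proof. by move=> c u v; rewrite !tensE; apply: bilin_ext_linearl. Qed.

Lemma tens_linearr u : linear (fun y => tens u y).
Proof. by move=> c x y; rewrite !tensE linearP. Qed.

Lemma tensU (a : A) (b : B) :
  tens << a >> << b >> = << (a, b) >> :> {malg K[(A * B)%type]}.
Proof. by rewrite tensE bilin_extU. Qed.

HB.instance Definition _ u :=
  GRing.isLinear.Build K {malg K[B]} {malg K[(A * B)%type]} *:%R (tens u)
    (tens_linearr u).

Definition tensr y u := tens u y.
HB.instance Definition _ y :=
  GRing.isLinear.Build K {malg K[A]} {malg K[(A * B)%type]} *:%R (tensr y)
    (tens_linearl y).

Lemma tens0l y : tens (0 : {malg K[A]}) y = 0.
Proof. exact: (linear0 (tensr y)). Qed.

Lemma tensBl u v y : tens (u - v) y = tens u y - tens v y.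
Proof. exact: (linearB (tensr y)). Qed.

Lemma tensZl c u y : tens (c *: u) y = c *: tens u y.
Proof. exact: (linearZ_LR (tensr y)). Qed.

Lemma tens_suml (I : Type) (r : seq I) (F : I -> {malg K[A]}) y :
  tens (\sum_(i <- r) F i) y = \sum_(i <- r) tens (F i) y.
Proof. exact: (linear_sum (tensr y)). Qed.

End TensorLinear.

(** * Words and deconcatenation over an arbitrary basis *)

Section Words.
Variable B : choiceType.
Local Notation H := {malg K[B]}.
Local Notation TH := {malg K[seq B]}.
Local Notation TT := {malg K[(seq B * seq B)%type]}.
Implicit Types (u v : H) (x y : TH).

Definition consW u x : TH :=
  \sum_(a <- msupp u) \sum_(w <- msupp x) << (u@_a * x@_w) *g (a :: w) >>.

Lemma consWE u x : consW u x = bilin_ext (fun a w => << a :: w >> : TH) u x.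
Proof.
rewrite bilin_extE; apply: eq_bigr => a _; apply: eq_bigr => w _.
by apply/malgP=> c; rewrite mcoeffZ !mcoeffU mulr_natr.
Qed.

Lemma consW_linearl x : linear (fun u => consW u x).
Proof. by move=> c u v; rewrite !consWE; apply: bilin_ext_linearl. Qed.

Lemma consW_linearr u : linear (consW u).
Proof. by move=> c x y; rewrite !consWE linearP. Qed.

Lemma consWU a w : consW << a >> << w >> = << a :: w >>.
Proof. by rewrite consWE bilin_extU. Qed.

HB.instance Definition _ u :=
  GRing.isLinear.Build K TH TH *:%R (consW u) (consW_linearr u).

Definition consWr x u := consW u x.
HB.instance Definition _ x :=
  GRing.isLinear.Build K H TH *:%R (consWr x) (consW_linearl x).

Lemma consW0l x : consW 0 x = 0.
Proof. exact: (linear0 (consWr x)). Qed.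

Lemma consWZl c u x : consW (c *: u) x = c *: consW u x.
Proof. exact: (linearZ_LR (consWr x)). Qed.

Lemma consW_nil u x : (consW u x)@_[::] = 0.
Proof.
rewrite raddf_sum big1 // => a _; rewrite raddf_sum big1 // => w _.
by rewrite /= mcoeffU.
Qed.

Definition deconc (x : TH) : TT :=
  lin_ext (fun w : seq B =>
    \sum_(i < (size w).+1) << (take i w, drop i w) >> : TT) x.
HB.instance Definition _ :=
  GRing.isLinear.Build K TH TT *:%R deconc (lin_ext_linear _).

Lemma deconcU w :
  deconc << w >> = \sum_(i < (size w).+1) << (take i w, drop i w) >>.
Proof. exact: lin_extU. Qed.

Definition consTT u : TT -> TT :=
  lin_ext (fun p => tens (consW u << p.1 >>) << p.2 >>).
HB.instance Definition _ u :=
  GRing.isLinear.Build K TT TT *:%R (consTT u) (lin_ext_linear _).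

Lemma consTT_tens u x y : consTT u (tens x y) = tens (consW u x) y.
Proof.
apply: (linear_ext_eq (f := fun x => consTT u (tens x y))
                      (g := fun x => tens (consW u x) y)) => [||w].
- exact: (linear_comp_fun (lin_ext_linear _) (tens_linearl _)).
- exact: (linear_comp_fun (tens_linearl _) (consW_linearr _)).
apply: (linear_ext_eq (f := fun y => consTT u (tens << w >> y))
                      (g := fun y => tens (consW u << w >>) y)) => [||w'].
- exact: (linear_comp_fun (lin_ext_linear _) (tens_linearr _)).
- exact: tens_linearr.
by rewrite tensU /consTT lin_extU.
Qed.

Lemma consTT0 z : consTT 0 z = 0.
Proof.
rewrite /consTT /lin_ext big1 // => p _.
by rewrite consW0l tens0l scaler0.
Qed.

(** A word starting with [u] is cut either before [u], which leaves the left factor empty, or after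
    it, and then [u] heads the left factor. *)
Lemma deconc_cons u x :
  deconc (consW u x) = tens << [::] >> (consW u x) + consTT u (deconc x).
Proof.
apply: (linear_ext_eq (f := fun x => deconc (consW u x))
  (g := fun x => tens << [::] >> (consW u x) + consTT u (deconc x))) => [||w].
- exact: (linear_comp_fun (lin_ext_linear _) (consW_linearr _)).
- apply: linear_add_fun.
    exact: (linear_comp_fun (tens_linearr _) (consW_linearr _)).
  exact: (linear_comp_fun (lin_ext_linear _) (lin_ext_linear _)).
have consTT_deconc v : consTT v (deconc << w >>) =
    \sum_(i < (size w).+1) tens (consW v << take i w >>) << drop i w >>.
  rewrite deconcU (linear_sum (consTT v)) /=; apply: eq_bigr => i _.
  by rewrite /consTT lin_extU.
rewrite consTT_deconc.
apply: (linear_ext_eq (f := fun u => deconc (consW u << w >>))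
  (g := fun u => tens << [::] >> (consW u << w >>) +
    \sum_(i < (size w).+1) tens (consW u << take i w >>) << drop i w >>)) => [||a].
- exact: (linear_comp_fun (lin_ext_linear _) (consW_linearl _)).
- apply: linear_add_fun.
    exact: (linear_comp_fun (tens_linearr _) (consW_linearl _)).
  apply: linear_sum_fun => i.
  exact: (linear_comp_fun (tens_linearl _) (consW_linearl _)).
rewrite consWU deconcU /= big_ord_recl take0 drop0 tensU; congr (_ + _).
by apply: eq_bigr => i _; rewrite consWU tensU.
Qed.

End Words.
End Tensor.

(** * Cofreeness of infinitesimal bialgebras *)

(** A connected infinitesimal bialgebra whose product and coproduct are described on a basis. The
    counit laws isolate the term containing [one] and leave a tail of nonzero degree, which is the
    form that recursion on the degree consumes. *)
Record inf_bialgebra_basis (B : choiceType) := InfBialgebraBasis {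
  deg : B -> nat;
  one : B;
  cop : B -> seq (B * B);
  star : B -> B -> B;
  deg_one : deg one = 0%N;
  deg0_one : forall t, deg t = 0%N -> t = one;
  deg_cop : forall t p, p \in cop t -> (deg p.1 + deg p.2)%N = deg t;
  deg_star : forall t s, deg (star t s) = (deg t + deg s)%N;
  star_oner : right_id one star;
  star_onel : left_id one star;
  cop_counitl : forall (V : zmodType) t (F : B * B -> V),
    \sum_(p <- cop t) F p = F (one, t) + \sum_(p <- cop t | deg p.1 != 0%N) F p;
  cop_counitr : forall (V : zmodType) t (F : B * B -> V),
    \sum_(p <- cop t) F p = F (t, one) + \sum_(p <- cop t | deg p.2 != 0%N) F p;
  cop_coassoc : forall (V : zmodType) t (F : B -> B -> B -> V),
    \sum_(p <- cop t) \sum_(q <- cop p.2) F p.1 q.1 q.2 =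
    \sum_(p <- cop t) \sum_(q <- cop p.1) F q.1 q.2 p.2;
  cop_star : forall (V : zmodType) t s (F : B * B -> V),
    \sum_(p <- cop (star t s)) F p =
    \sum_(p <- cop t) F (p.1, star p.2 s) + \sum_(p <- cop s) F (star t p.1, p.2)
    - F (t, s)
}.

Section Cofree.
Variables (K : fieldType) (B : choiceType) (S : inf_bialgebra_basis B).
Local Notation H := {malg K[B]}.
Local Notation HH := {malg K[(B * B)%type]}.
Local Notation TH := {malg K[seq B]}.
Local Notation TT := {malg K[(seq B * seq B)%type]}.
Local Notation deg := (deg S).
Local Notation one := (one S).
Local Notation cop := (cop S).
Local Notation star := (star S).

Lemma deg_cop1 t p : p \in cop t -> deg p.2 != 0%N -> (deg p.1 < deg t)%N.
Proof. by move=> /deg_cop <-; case: (deg p.2) => // n _; rewrite addnS ltnS leq_addr. Qed.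

Lemma deg_cop2 t p : p \in cop t -> deg p.1 != 0%N -> (deg p.2 < deg t)%N.
Proof. by move=> /deg_cop <-; case: (deg p.1) => // n _; rewrite addSn ltnS leq_addl. Qed.

Lemma deg_ind (P : B -> Prop) :
  (forall t, (forall s, (deg s < deg t)%N -> P s) -> P t) -> forall t, P t.
Proof.
move=> IH t; have [n] := ubnP (deg t); elim: n t => // n IHn t tn.
by apply: IH => s st; apply: IHn; apply: leq_trans st _.
Qed.

Section DegRec.
Variables (V : Type) (v0 : V) (step : (B -> V) -> B -> V).

(** The index is fuel. With more fuel than the degree of the argument, the default [v0] has no
    influence on the value as soon as [step] only looks at smaller degrees. *)
Fixpoint deg_iter n : B -> V :=
  if n is m.+1 then step (deg_iter m) else fun=> v0.

Definition deg_rec (t : B) : V := deg_iter (deg t).+1 t.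

Hypothesis step_ext : forall f g t,
  (forall s, (deg s < deg t)%N -> f s = g s) -> step f t = step g t.

Lemma deg_recE t : deg_rec t = step deg_rec t.
Proof.
have stab n m s : (deg s < n)%N -> (deg s < m)%N -> deg_iter n s = deg_iter m s.
  elim: n m s => // n IHn [//|m] s /= sn sm; apply: step_ext => s' s's.
  by apply: IHn; apply: leq_trans s's _.
by apply: (@step_ext (deg_iter (deg t))) => s st; apply: stab.
Qed.

End DegRec.

Arguments deg_rec : simpl never.

(** * Product, coproduct and primitivity on linear combinations *)

Definition starH : H -> H -> H := bilin_ext (fun t s => << star t s >>).

Lemma starHU t s : starH << t >> << s >> = << star t s >>.
Proof. exact: bilin_extU. Qed.

Lemma starH_linearl y : linear (starH ^~ y).
Proof. exact: bilin_ext_linearl. Qed.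

Lemma starH_linearr x : linear (starH x).
Proof. exact: bilin_ext_linearr. Qed.

HB.instance Definition _ (x : H) :=
  GRing.isLinear.Build K H H *:%R (starH x) (starH_linearr x).

Definition starHr (y x : H) := starH x y.
HB.instance Definition _ (y : H) :=
  GRing.isLinear.Build K H H *:%R (starHr y) (starH_linearl y).

Lemma starH0l y : starH 0 y = 0.
Proof. exact: (linear0 (starHr y)). Qed.

Lemma starHZl c x y : starH (c *: x) y = c *: starH x y.
Proof. exact: (linearZ_LR (starHr y)). Qed.

Definition coprod : H -> HH := lin_ext (fun t => \sum_(p <- cop t) << p >>).
HB.instance Definition _ :=
  GRing.isLinear.Build K H HH *:%R coprod (lin_ext_linear _).

Lemma coprodU t : coprod << t >> = \sum_(p <- cop t) << p >>.
Proof. exact: lin_extU. Qed.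

Definition epsB (t : B) : K := (deg t == 0%N)%:R.
Definition counit : H -> K^o := lin_ext (epsB : B -> K^o).
HB.instance Definition _ :=
  GRing.isLinear.Build K H K^o *:%R counit (lin_ext_linear _).

Lemma counitU t : counit << t >> = epsB t.
Proof. exact: lin_extU. Qed.

Lemma sum_eps1 (V : lmodType K) t (F : B -> V) :
  \sum_(p <- cop t) epsB p.1 *: F p.2 = F t.
Proof.
rewrite cop_counitl big1 /= => [|p /negbTE p1]; last by rewrite /epsB p1 scale0r.
by rewrite /epsB deg_one addr0 scale1r.
Qed.

Lemma starH1r (x : H) : starH x << one >> = x.
Proof.
apply: (linear_ext_eq (f := starHr << one >>) (g := id)) => [||t] //.
  exact: linearP.
by rewrite /starHr starHU star_oner.
Qed.

Lemma cop_one_tail (V : zmodType) (F : B * B -> V) :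
  \sum_(p <- cop one | deg p.2 != 0%N) F p = 0.
Proof.
rewrite big_seq_cond big1 // => p /andP[+ p2].
by move=> /deg_cop1 /(_ p2); rewrite deg_one.
Qed.

Lemma coprod1 : coprod << one >> = << (one, one) >>.
Proof. by rewrite coprodU cop_counitr cop_one_tail addr0. Qed.

Definition prim_defect (x : H) : HH :=
  coprod x - tens x << one >> - tens << one >> x.

Lemma prim_defect_linear : linear prim_defect.
Proof.
apply: linear_sub_fun (tens_linearr _).
exact: (linear_sub_fun (lin_ext_linear _) (tens_linearl _)).
Qed.
HB.instance Definition _ :=
  GRing.isLinear.Build K H HH *:%R prim_defect prim_defect_linear.

Definition prim (x : H) := coprod x == tens x << one >> + tens << one >> x.

Lemma primP (x : H) : reflect (prim_defect x = 0) (prim x).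
Proof. by rewrite /prim -subr_eq0 opprD addrA; exact: eqP. Qed.

Definition starHH (s : B) : HH -> HH :=
  lin_ext (fun p => << (p.1, star p.2 s) >>).
HB.instance Definition _ s :=
  GRing.isLinear.Build K HH HH *:%R (starHH s) (lin_ext_linear _).

Lemma starHHU s p : starHH s << p >> = << (p.1, star p.2 s) >>.
Proof. exact: lin_extU. Qed.

Lemma starHH1 z : starHH one z = z.
Proof.
apply: (linear_ext_eq (f := starHH one) (g := id)) => [||[a b]] //.
  exact: linearP.
by rewrite starHHU star_oner.
Qed.

(** The infinitesimal relation, with the failure of [x] to be primitive collected in one linear
    term. Allowing arbitrary [x] matters in [primB_prim], where primitivity is still to be
    proved. *)
Lemma coprod_star (x : H) s :
  coprod (starH x << s >>) =
  tens << one >> (starH x << s >>)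
  + \sum_(q <- cop s) tens (starH x << q.1 >>) << q.2 >>
  + starHH s (prim_defect x).
Proof.
have starl := @starH_linearl << s >>.
apply: (linear_ext_eq (f := fun x => coprod (starH x << s >>))
  (g := fun x => tens << one >> (starH x << s >>)
    + \sum_(q <- cop s) tens (starH x << q.1 >>) << q.2 >>
    + starHH s (prim_defect x))) => [||t].
- exact: (linear_comp_fun (lin_ext_linear _) starl).
- apply: linear_add_fun; last first.
    exact: (linear_comp_fun (lin_ext_linear _) prim_defect_linear).
  apply: linear_add_fun (linear_comp_fun (tens_linearr _) starl) _.
  apply: linear_sum_fun => q.
  exact: (linear_comp_fun (tens_linearl _) (starH_linearl _)).
have -> : starHH s (prim_defect << t >>) =
    \sum_(p <- cop t) << (p.1, star p.2 s) >> - << (t, s) >>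
    - << (one, star t s) >>.
  rewrite /prim_defect coprodU !tensU.
  rewrite 2!(linearB (starHH s)) (linear_sum (starHH s)) /= !starHHU star_onel.
  by rewrite (eq_bigr _ (fun p _ => starHHU s p)).
rewrite starHU coprodU cop_star tensU.
under [in RHS]eq_bigr do rewrite starHU tensU.
by rewrite [in RHS]addrC addrA subrK addrAC.
Qed.

(* [primBE] says that [eta eps - primB] is the convolution inverse of the identity. *)
Definition primB : B -> H :=
  deg_rec 0 (fun f t => << t >> - epsB t *: << one >>
    - \sum_(p <- cop t | deg p.2 != 0%N) starH (f p.1) << p.2 >>).

Lemma primB_rec t :
  primB t = << t >> - epsB t *: << one >>
    - \sum_(p <- cop t | deg p.2 != 0%N) starH (primB p.1) << p.2 >>.
Proof.
rewrite {1}/primB deg_recE; [exact: erefl | move=> f g s fg].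
congr (_ - _); rewrite big_seq_cond [RHS]big_seq_cond.
by apply: eq_bigr => p /andP[ps p2]; rewrite fg // deg_cop1.
Qed.

Lemma primBE t :
  \sum_(p <- cop t) starH (primB p.1) << p.2 >> = << t >> - epsB t *: << one >>.
Proof.
rewrite cop_counitr; apply: etrans (congr1 (+%R^~ _) (starH1r (primB t))) _.
by rewrite /= [primB t]primB_rec subrK.
Qed.

Lemma primB_one : primB one = 0.
Proof.
by rewrite primB_rec cop_one_tail subr0 /epsB deg_one scale1r subrr.
Qed.

(** Applying the coproduct to [primBE t] makes everything cancel by coassociativity, except the
    defects of the [primB p.1]. By induction only the defect at [p = (t, one)] survives, hence it is
    zero. *)
Lemma primB_prim t : prim (primB t).
Proof.
apply/primP; elim/deg_ind: t => t IH.
have := congr1 coprod (primBE t); rewrite linear_sum /=.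
rewrite (eq_bigr _ (fun p _ => coprod_star (primB p.1) p.2)) !big_split /=.
rewrite -linear_sum primBE /=.
rewrite (cop_coassoc S t (fun a b c => tens (starH (primB a) << b >>) << c >>)).
(* The inner sum is [primBE] at [p.1]; its counit part collapses the outer sum to the single term
   [tens << one >> << t >>]. *)
have -> : \sum_(p <- cop t) \sum_(q <- cop p.1)
      tens (starH (primB q.1) << q.2 >>) << p.2 >> =
    coprod << t >> - tens << one >> << t >>.
  rewrite coprodU -(sum_eps1 t (fun c => tens << one >> << c >>)) -sumrB.
  apply: eq_bigr => -[a b] _.
  by rewrite -tens_suml primBE tensBl tensZl !tensU.
rewrite cop_counitr [X in _ + (_ + X)]big1_seq ?addr0 => [|p /andP[p2 pt]]; last first.
  by rewrite IH ?linear0 // (deg_cop1 pt).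
rewrite starHH1.
have -> : coprod (<< t >> - epsB t *: << one >>) =
    coprod << t >> - epsB t *: << (one, one) >>.
  by rewrite linearB linearZ /= coprod1.
have -> : tens << one >> (<< t >> - epsB t *: << one >>) =
    tens << one >> << t >> - epsB t *: << (one, one) >> :> HH.
  by rewrite linearB linearZ /= !tensU.
rewrite [X in X + _ = _]addrC subrKA.
by rewrite -[X in _ = X]addr0 => /addrI.
Qed.

Definition projP : H -> H := lin_ext primB.
HB.instance Definition _ :=
  GRing.isLinear.Build K H H *:%R projP (lin_ext_linear _).

(** The series over iterated coproducts in recursive form: e of the first piece is the first letter,
    and the second piece is treated in turn. As e kills the unit, pieces with [p.1] of degree 0 may
    be dropped, so the recursion descends. *)
Definition cofreeB : B -> TH :=
  deg_rec 0 (fun f t => epsB t *: << [::] >>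
    + \sum_(p <- cop t | deg p.1 != 0%N) consW (primB p.1) (f p.2)).

Lemma cofreeBE t : cofreeB t =
  epsB t *: << [::] >> + \sum_(p <- cop t) consW (primB p.1) (cofreeB p.2).
Proof.
rewrite cop_counitl primB_one consW0l add0r {1}/cofreeB.
rewrite deg_recE; [exact: erefl | move=> f g s fg].
congr (_ + _); rewrite big_seq_cond [RHS]big_seq_cond.
by apply: eq_bigr => p /andP[ps p1]; rewrite fg // deg_cop2.
Qed.

Lemma cofreeB_sum t :
  \sum_(p <- cop t) consW (primB p.1) (cofreeB p.2) =
  cofreeB t - epsB t *: << [::] >>.
Proof. by rewrite [cofreeB t in RHS]cofreeBE [_ *: _ + _]addrC addrK. Qed.

(** This lets inductions run over the whole of [cop t], to which coassociativity applies: the term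
    outside the reach of the induction hypothesis vanishes. *)
Lemma cop_primB_case t p : p \in cop t ->
  primB p.1 = 0 \/ (deg p.2 < deg t)%N.
Proof.
move=> pt; have [/deg0_one -> | p1] := eqVneq (deg p.1) 0%N.
  by left; apply: primB_one.
by right; apply: deg_cop2 p1.
Qed.

Definition cofree : H -> TH := lin_ext cofreeB.
HB.instance Definition _ :=
  GRing.isLinear.Build K H TH *:%R cofree (lin_ext_linear _).

Lemma cofreeU t : cofree << t >> = cofreeB t.
Proof. exact: lin_extU. Qed.

Lemma cofree_one : cofree << one >> = << [::] >>.
Proof.
rewrite cofreeU cofreeBE cop_counitr primB_one consW0l cop_one_tail !addr0.
by rewrite /epsB deg_one scale1r.
Qed.

Definition tensorP (f : H -> TH) : HH -> TT :=
  lin_ext (fun p => tens (f << p.1 >>) (f << p.2 >>)).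

Lemma deconc_nil : deconc << [::] >> = << ([::], [::]) >> :> TT.
Proof. by rewrite deconcU big_ord_recl big_ord0 addr0. Qed.

(** Cutting after the first letter [primB p.1] gives, by induction, a sum over the coproduct of
    [p.2]. Coassociativity moves the inner sum to the left factor, where [cofreeB_sum] rebuilds
    [cofreeB]; the cut before the first letter supplies the missing term. *)
Lemma deconc_cofreeB t :
  deconc (cofreeB t) = \sum_(p <- cop t) tens (cofreeB p.1) (cofreeB p.2).
Proof.
elim/deg_ind: t => t IH.
rewrite cofreeBE linearD linearZ linear_sum /= deconc_nil.
have -> : \sum_(p <- cop t) deconc (consW (primB p.1) (cofreeB p.2)) =
    tens << [::] >> (cofreeB t - epsB t *: << [::] >>) +
    \sum_(p <- cop t) \sum_(q <- cop p.2)
       tens (consW (primB p.1) (cofreeB q.1)) (cofreeB q.2).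
  rewrite -cofreeB_sum linear_sum -big_split /=; apply: eq_big_seq => p pt.
  rewrite deconc_cons; congr (_ + _).
  have [p1 | p2] := cop_primB_case pt.
    by rewrite p1 consTT0 big1 // => q _; rewrite consW0l tens0l.
  rewrite IH // (linear_sum (consTT _)); apply: eq_bigr => q _.
  exact: consTT_tens.
rewrite (cop_coassoc S t
  (fun a b c => tens (consW (primB a) (cofreeB b)) (cofreeB c))).
have -> : \sum_(p <- cop t) \sum_(q <- cop p.1)
      tens (consW (primB q.1) (cofreeB q.2)) (cofreeB p.2) =
    \sum_(p <- cop t) tens (cofreeB p.1) (cofreeB p.2)
    - tens << [::] >> (cofreeB t).
  rewrite -(sum_eps1 t (fun c => tens << [::] >> (cofreeB c))) -sumrB.
  apply: eq_bigr => p _.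
  by rewrite -tens_suml cofreeB_sum tensBl tensZl.
rewrite linearB linearZ /= tensU [X in _ + X]addrC subrKA.
by rewrite addrC subrK.
Qed.

Lemma deconc_cofree x : deconc (cofree x) = tensorP cofree (coprod x).
Proof.
apply: (linear_ext_eq (f := fun x => deconc (cofree x))
                      (g := fun x => tensorP cofree (coprod x))) => [||t].
- exact: (linear_comp_fun (lin_ext_linear _) (lin_ext_linear _)).
- exact: (linear_comp_fun (lin_ext_linear _) (lin_ext_linear _)).
rewrite cofreeU deconc_cofreeB coprodU /tensorP linear_sum /=.
by apply: eq_bigr => p _; rewrite lin_extU !cofreeU.
Qed.

Lemma cofree_counit x : (cofree x)@_[::] = counit x.
Proof.
apply: (linear_ext_eq (f := fun x => (cofree x)@_[::] : K^o)
                      (g := counit)) => [||t].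
- by move=> c u v; rewrite linearP mcoeffD mcoeffZ.
- exact: linearP.
rewrite cofreeU counitU cofreeBE mcoeffD mcoeffZ mcoeffUU mulr1 raddf_sum.
by rewrite big1 ?addr0 // => p _; apply: consW_nil.
Qed.

Definition evalW : TH -> H :=
  lin_ext (foldr (fun a x => starH << a >> x) << one >>).
HB.instance Definition _ :=
  GRing.isLinear.Build K TH H *:%R evalW (lin_ext_linear _).

Lemma evalW_cons u x : evalW (consW u x) = starH u (evalW x).
Proof.
apply: (linear_ext_eq (f := fun x => evalW (consW u x))
                      (g := fun x => starH u (evalW x))) => [||w].
- exact: (linear_comp_fun (lin_ext_linear _) (consW_linearr _)).
- exact: (linear_comp_fun (starH_linearr _) (lin_ext_linear _)).
apply: (linear_ext_eq (f := fun u => evalW (consW u << w >>))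
                      (g := fun u => starH u (evalW << w >>))) => [||a].
- exact: (linear_comp_fun (lin_ext_linear _) (consW_linearl _)).
- exact: starH_linearl.
by rewrite consWU /evalW !lin_extU.
Qed.

(** Once the tails are evaluated by induction, the remaining sum is the left side of [primBE]. *)
Lemma cofreeBK t : evalW (cofreeB t) = << t >>.
Proof.
elim/deg_ind: t => t IH.
rewrite cofreeBE linearD linearZ linear_sum /= {1}/evalW lin_extU /=.
rewrite (eq_big_seq (fun p => starH (primB p.1) << p.2 >>)) => [|p pt].
  by rewrite primBE addrC subrK.
rewrite evalW_cons; have [-> | p2] := cop_primB_case pt; first by rewrite !starH0l.
by rewrite IH.
Qed.

Lemma cofreeK : cancel cofree evalW.
Proof.
apply: (linear_ext_eq (f := fun x => evalW (cofree x)) (g := id)) => [||t] //.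
  exact: (linear_comp_fun (lin_ext_linear _) (lin_ext_linear _)).
by rewrite cofreeU cofreeBK.
Qed.

Definition wordP (s : seq H) : TH := foldr (@consW K B) << [::] >> s.

Definition in_TP (y : TH) : Prop :=
  exists l : seq (K * seq H),
    all (fun p => all prim p.2) l /\ y = \sum_(p <- l) p.1 *: wordP p.2.

Lemma in_TP0 : in_TP 0.
Proof. by exists [::]; rewrite big_nil. Qed.

Lemma in_TPD x y : in_TP x -> in_TP y -> in_TP (x + y).
Proof.
move=> [l [pl ->]] [m [pm ->]]; exists (l ++ m).
by rewrite all_cat pl pm big_cat.
Qed.

Lemma in_TPZ c x : in_TP x -> in_TP (c *: x).
Proof.
move=> [l [pl ->]]; exists [seq (c * p.1, p.2) | p <- l]; split.
  by rewrite all_map.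
by rewrite big_map scaler_sumr; apply: eq_bigr => p _; rewrite scalerA.
Qed.

Lemma in_TP_sum (I : eqType) (r : seq I) (F : I -> TH) :
  {in r, forall i, in_TP (F i)} -> in_TP (\sum_(i <- r) F i).
Proof.
by move=> h; rewrite big_seq; elim/big_ind: _ => //; [exact: in_TP0 | exact: in_TPD].
Qed.

Lemma in_TP_cons u x : prim u -> in_TP x -> in_TP (consW u x).
Proof.
move=> pu [l [pl ->]]; exists [seq (p.1, u :: p.2) | p <- l]; split.
  by rewrite all_map; apply: sub_all pl => p /= ->; rewrite pu.
rewrite big_map linear_sum; apply: eq_bigr => p _.
by rewrite linearZ.
Qed.

Lemma cofreeB_in_TP t : in_TP (cofreeB t).
Proof.
elim/deg_ind: t => t IH; rewrite cofreeBE; apply: in_TPD.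
  by apply: in_TPZ; exists [:: (1, [::])]; rewrite big_seq1 scale1r.
apply: in_TP_sum => p pt; have [-> | p2] := cop_primB_case pt.
  by rewrite consW0l; apply: in_TP0.
by apply: in_TP_cons (IH _ p2); apply: primB_prim.
Qed.

Lemma cofree_in_TP x : in_TP (cofree x).
Proof. by apply: in_TP_sum => a _; apply/in_TPZ/cofreeB_in_TP. Qed.

(** * Left multiplication by a primitive is prepending a letter *)

Lemma coprod_star_prim x s : prim x ->
  coprod (starH x << s >>) =
  tens << one >> (starH x << s >>)
  + \sum_(q <- cop s) tens (starH x << q.1 >>) << q.2 >>.
Proof. by move=> /primP px; rewrite coprod_star px linear0 addr0. Qed.

Lemma counit_prim x : prim x -> counit x = 0.
Proof.
(* [E] is the counit on the left factor. Applied to the primitivity equation it gives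
   [x = counit x *: << one >> + x]. *)
pose E : HH -> H := lin_ext (fun p => epsB p.1 *: << p.2 >>).
have Etens y z : E (tens y z) = counit y *: z.
  apply: (linear_ext_eq (f := fun y => E (tens y z))
                        (g := fun y => counit y *: z)) => [||a].
  - exact: (linear_comp_fun (lin_ext_linear _) (tens_linearl _)).
  - by move=> c u v; rewrite linearP scalerDl scalerA.
  apply: (linear_ext_eq (f := fun z => E (tens << a >> z))
                        (g := fun z => counit << a >> *: z)) => [||b].
  - exact: (linear_comp_fun (lin_ext_linear _) (tens_linearr _)).
  - by move=> c u v; rewrite scalerDr !scalerA mulrC.
  by rewrite tensU /E lin_extU counitU.
have Ecoprod y : E (coprod y) = y.
  apply: (linear_ext_eq (f := fun y => E (coprod y)) (g := id)) => [||t] //.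
    exact: (linear_comp_fun (lin_ext_linear _) (lin_ext_linear _)).
  rewrite coprodU /E linear_sum /= -[RHS](sum_eps1 t (fun b => << b >>)).
  by apply: eq_bigr => p _; rewrite lin_extU.
have ED u v : E (u + v) = E u + E v by exact: linearD.
move=> /eqP px; have := Ecoprod x; rewrite px ED !Etens.
rewrite counitU /epsB deg_one scale1r => /eqP.
rewrite -subr_eq0 addrK => /eqP /(congr1 (mcoeff one)).
by rewrite mcoeffZ mcoeffUU mulr1 mcoeff0.
Qed.

Lemma counit_star x s : counit (starH x << s >>) = counit x * epsB s.
Proof.
apply: (linear_ext_eq (f := fun x => counit (starH x << s >>))
                      (g := fun x => counit x * epsB s : K^o)) => [||t].
- exact: (linear_comp_fun (lin_ext_linear _) (starH_linearl _)).
- by move=> c u v; rewrite linearP mulrDl -mulrA.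
by rewrite starHU !counitU /epsB deg_star addn_eq0 -natrM mulnb.
Qed.

(** Both e(x * s) and eps(s) x solve the same convolution equation in [s], whose solution is unique
    by induction on the degree. The case [s = one] says that e fixes every primitive. *)
Lemma projP_star x s : prim x -> projP (starH x << s >>) = epsB s *: x.
Proof.
move=> px; elim/deg_ind: s => s IH.
(* [M] applies e to the left factor and multiplies, so that [Mcoprod] is the linear extension of
   [primBE]. *)
pose M : HH -> H := lin_ext (fun p => starH (primB p.1) << p.2 >>).
have Mtens y b : M (tens y << b >>) = starH (projP y) << b >>.
  apply: (linear_ext_eq (f := fun y => M (tens y << b >>))
                        (g := fun y => starH (projP y) << b >>)) => [||a].
  - exact: (linear_comp_fun (lin_ext_linear _) (tens_linearl _)).
  - exact: (linear_comp_fun (starH_linearl _) (lin_ext_linear _)).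
  by rewrite tensU /M /projP !lin_extU.
have M1 y : M (tens << one >> y) = 0.
  apply: (linear_ext_eq (f := fun y => M (tens << one >> y))
                        (g := fun=> 0)) => [||b].
  - exact: (linear_comp_fun (lin_ext_linear _) (tens_linearr _)).
  - by move=> c u v; rewrite scaler0 addr0.
  by rewrite tensU /M lin_extU primB_one starH0l.
have Mcoprod y : M (coprod y) = y - counit y *: << one >>.
  apply: (linear_ext_eq (f := fun y => M (coprod y))
                        (g := fun y => y - counit y *: << one >>)) => [||t].
  - exact: (linear_comp_fun (lin_ext_linear _) (lin_ext_linear _)).
  - apply: linear_sub_fun => // c u v.
    by rewrite linearP scalerDl scalerA.
  rewrite coprodU counitU -primBE /M linear_sum /=.
  by apply: eq_bigr => p _; rewrite lin_extU.
have MD u v : M (u + v) = M u + M v by exact: linearD.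
have Msum (r : seq (B * B)) F : M (\sum_(p <- r) F p) = \sum_(p <- r) M (F p).
  exact: linear_sum.
have := Mcoprod (starH x << s >>).
rewrite counit_star counit_prim // mul0r scale0r subr0 coprod_star_prim //.
rewrite MD M1 add0r Msum.
under eq_bigr do rewrite Mtens.
rewrite -[X in _ = X](sum_eps1 s (fun b => starH x << b >>)).
have tail : \sum_(q <- cop s | deg q.2 != 0%N) starH (projP (starH x << q.1 >>)) << q.2 >> =
    \sum_(q <- cop s | deg q.2 != 0%N) epsB q.1 *: starH x << q.2 >>.
  rewrite big_seq_cond [RHS]big_seq_cond; apply: eq_bigr => q /andP[qs q2].
  by rewrite IH ?starHZl // (deg_cop1 qs).
(* The tails agree by induction; cancelling them leaves the terms at [(s, one)], which are the two
   sides of the claim. *)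
rewrite [LHS]cop_counitr [X in _ = X]cop_counitr tail => /addIr.
by rewrite !starH1r.
Qed.

Lemma cofreeE z :
  cofree z = counit z *: << [::] >>
    + lin_ext (fun p => consW (primB p.1) (cofreeB p.2)) (coprod z).
Proof.
apply: (linear_ext_eq (f := cofree) (g := fun z => counit z *: << [::] >>
    + lin_ext (fun p => consW (primB p.1) (cofreeB p.2)) (coprod z))) => [||t].
- exact: lin_ext_linear.
- apply: linear_add_fun; first by move=> c u v; rewrite linearP scalerDl scalerA.
  exact: (linear_comp_fun (lin_ext_linear _) (lin_ext_linear _)).
rewrite cofreeU cofreeBE counitU coprodU linear_sum /=; congr (_ + _).
by apply: eq_bigr => p _; rewrite lin_extU.
Qed.

(** In the recursion for [starH x << s >>], each first letter is e(x * q.1), that is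
    [epsB q.1 *: x], so only the term with [q.1 = one] remains. *)
Lemma cofree_starU x s :
  prim x -> cofree (starH x << s >>) = consW x (cofreeB s).
Proof.
move=> px; rewrite cofreeE counit_star counit_prim // mul0r scale0r add0r.
set N : HH -> TH := lin_ext _.
have Ntens y b : N (tens y << b >>) = consW (projP y) (cofreeB b).
  apply: (linear_ext_eq (f := fun y => N (tens y << b >>))
                        (g := fun y => consW (projP y) (cofreeB b))) => [||a].
  - exact: (linear_comp_fun (lin_ext_linear _) (tens_linearl _)).
  - exact: (linear_comp_fun (consW_linearl _) (lin_ext_linear _)).
  by rewrite tensU /N /projP !lin_extU.
have N1 y : N (tens << one >> y) = 0.
  apply: (linear_ext_eq (f := fun y => N (tens << one >> y))
                        (g := fun=> 0)) => [||b].
  - exact: (linear_comp_fun (lin_ext_linear _) (tens_linearr _)).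
  - by move=> c u v; rewrite scaler0 addr0.
  by rewrite tensU /N lin_extU primB_one consW0l.
have ND u v : N (u + v) = N u + N v by exact: linearD.
have Nsum (r : seq (B * B)) F : N (\sum_(p <- r) F p) = \sum_(p <- r) N (F p).
  exact: linear_sum.
rewrite coprod_star_prim // ND N1 add0r Nsum.
rewrite -(sum_eps1 s (fun b => consW x (cofreeB b))).
by apply: eq_bigr => q _; rewrite Ntens projP_star // consWZl.
Qed.

Lemma cofree_star x y : prim x -> cofree (starH x y) = consW x (cofree y).
Proof.
move=> px; apply: (linear_ext_eq (f := fun y => cofree (starH x y))
                                 (g := fun y => consW x (cofree y))) => [||s].
- exact: (linear_comp_fun (lin_ext_linear _) (starH_linearr _)).
- exact: (linear_comp_fun (consW_linearr _) (lin_ext_linear _)).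
by rewrite cofree_starU // cofreeU.
Qed.

Lemma cofree_surj y : in_TP y -> exists x, cofree x = y.
Proof.
move=> [l [pl ->]].
(* The preimage of a word of primitives is their product nested to the right, so that [cofree_star]
   peels off one letter at a time. *)
exists (\sum_(p <- l) p.1 *: foldr starH << one >> p.2).
rewrite linear_sum; apply: eq_big_seq => p /(allP pl) pp.
rewrite linearZ /=; congr (_ *: _); elim: p.2 pp => [_|x s IHs /= /andP[px ps]].
  exact: cofree_one.
by rewrite cofree_star // IHs.
Qed.

End Cofree.

(** * The coalgebra of finite topologies *)

Definition topo_basis : inf_bialgebra_basis Topo :=
  @InfBialgebraBasis Topo (@tag _ _) oneT cutsT starT erefl topo_ord0 tag_cutsT
    (fun _ _ => erefl) starT_oner starT_onel cutsT_counitl cutsT_counitr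
    cutsT_coassoc cutsT_starT.

Section TopoCoalgebra.
Variable K : fieldType.

Lemma bas_val n (T : topo n) : bas K (val T) = << Tagged topo T >>.
Proof. by rewrite /bas valK. Qed.

Lemma oneHE : oneH K = << oneT >>.
Proof. by rewrite -bas_val. Qed.

(** The default value of [bas] never occurs: by [std_openE] each standardised restriction underlies
    a [pull], hence is a topology. *)
Lemma deltaBE t : deltaB K t = \sum_(p <- cutsT t) << p >>.
Proof.
case: t => n T; rewrite big_cutsT; apply: eq_bigr => O _.
have std_restrE Y : std_restr (val T) Y = val (pull T (@enum_val _ (mem Y))).
  by apply: eq_imset => U; rewrite std_openE.
by rewrite !std_restrE !bas_val tensU.
Qed.

Lemma deltaHE (x : H K) : deltaH x = coprod topo_basis x.
Proof. by apply: eq_bigr => t _; rewrite deltaBE. Qed.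

Lemma epsHE (x : H K) : epsH x = counit topo_basis x.
Proof.
rewrite /epsH big_mkcond; apply: eq_bigr => t _; rewrite /epsB /=.
by case: eqP => _; rewrite ?scaler0 // [_ *: _]mulr1.
Qed.

Lemma primitiveE (x : H K) : primitive x = prim topo_basis x.
Proof. by rewrite /primitive deltaHE oneHE. Qed.

Lemma concE (x : H K) (y : TH K) : conc x y = consW x y.
Proof. exact: erefl. Qed.

Lemma twordE (s : seq (H K)) : tword s = wordP s.
Proof. by elim: s => [|x s IHs]; [exact: erefl | rewrite /= concE IHs]. Qed.

Lemma in_TPrimE (y : TH K) : in_TPrim y <-> in_TP topo_basis y.
Proof.
have all_primE (l : seq (K * seq (H K))) :
    all (fun p => all (@primitive K) p.2) l = all (fun p => all (prim topo_basis) p.2) l.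
  by apply: eq_all => p; apply: eq_all => x; rewrite primitiveE.
have sumE (l : seq (K * seq (H K))) :
    \sum_(p <- l) p.1 *: tword p.2 = \sum_(p <- l) p.1 *: wordP p.2 :> TH K.
  by apply: eq_bigr => p _; rewrite twordE.
split=> -[l [pl eq_y]]; exists l; (split; last by rewrite eq_y sumE).
  by rewrite -all_primE.
by rewrite all_primE.
Qed.

End TopoCoalgebra.

Theorem theorem7 (K : fieldType) :
  exists phi : H K -> TH K,
    (forall (a : K) (u v : H K), phi (a *: u + v) = a *: phi u + phi v) /\
    injective phi /\
    (forall x, in_TPrim (phi x)) /\
    (forall y, in_TPrim y -> exists x, phi x = y) /\
    (forall x, deltaT (phi x) = tensmap phi (deltaH x)) /\
    (forall x, epsT (phi x) = epsH x).
Proof.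
exists (@cofree K _ topo_basis); split; first exact: lin_ext_linear.
split; first exact: can_inj (@cofreeK K _ topo_basis).
split=> [x|]; first by apply/in_TPrimE/cofree_in_TP.
split=> [y /in_TPrimE|]; first exact: cofree_surj.
split=> x; first by rewrite deltaHE; apply: deconc_cofree.
by rewrite epsHE; apply: cofree_counit.
Qed.
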